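(* Let $k$ be a positive integer and let $G$ be a $2k$-edge-connected, rayless and finitely edge-separable graph. Then $G$ contains $k$ pairwise edge-disjoint spanning trees.
   Context: All graphs are simple (no loops, no multiple edges) and may be of any cardinality. A graph $G$ is $m$-edge-connected if for every pair of vertices $u,v\in V(G)$ there are $m$ pairwise edge-disjoint $u$–$v$ paths in $G$. A graph is rayless if it contains no one-way infinite path. A graph is finitely edge-separable if every pair of distinct vertices can be separated by a finite set of edges. *)

(* Defs.v *)
From mathcomp Require Import all_boot.
From mathcomp Require Import boolp classical_sets functions cardinality.

Set Implicit Arguments.
Unset Strict Implicit.
Unset Printing Implicit Defensive.

Local Open Scope classical_set_scope.

Record sgraph (V : Type) := SGraph {
  adj :> rel V;
  adj_sym : symmetric adj;
  adj_irr : irreflexive adj }.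

(* An edge is represented by the unordered pair of its ends. *)
Definition edges (V : Type) (G : sgraph V) : set (set V) :=
  [set e | exists x y, G x y /\ e = [set x; y]].

(* The vertex sequence x :: p, without repetition; it is a trivial path,
   with no edge, when p is empty. *)
Definition upath (V : Type) (G : sgraph V) (x : V) (p : seq V) (y : V) : Prop :=
  [/\ path G x p, last x p = y & uniq (x :: p : seq {classic V})].

Fixpoint path_edges (V : Type) (x : V) (p : seq V) : set (set V) :=
  if p is y :: q then [set [set x; y]] `|` path_edges y q else set0.

Definition edge_connected (V : Type) (m : nat) (G : sgraph V) : Prop :=
  forall u v : V, exists P : 'I_m -> seq V,
    (forall i, upath G u (P i) v) /\
    trivIset [set: 'I_m] (fun i => path_edges u (P i)).

Definition rayless (V : Type) (G : sgraph V) : Prop :=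
  ~ exists r : nat -> V, injective r /\ forall n, G (r n) (r n.+1).

(* F separates u from v when every u-v path has an edge in F. *)
Definition separates (V : Type) (G : sgraph V) (F : set (set V)) (u v : V) :
    Prop :=
  forall p, upath G u p v -> path_edges u p `&` F !=set0.

Definition finitely_edge_separable (V : Type) (G : sgraph V) : Prop :=
  forall u v : V, u <> v ->
    exists F, [/\ finite_set F, F `<=` edges G & separates G F u v].

Definition connected_graph (V : Type) (G : sgraph V) : Prop :=
  forall u v : V, exists p, upath G u p v.

(* The length condition excludes the degenerate closed walks [::] and
   [:: x; y], which are cycles in the sense of path.v but not of graphs. *)
Definition acyclic (V : Type) (G : sgraph V) : Prop :=
  ~ exists c : seq V,
      [/\ (2 < size c)%N, cycle G c & uniq (c : seq {classic V})].

Definition is_tree (V : Type) (T : sgraph V) : Prop :=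
  connected_graph T /\ acyclic T.

(* T has the same vertex set V as G, so it is spanning by typing. *)
Definition spanning_tree (V : Type) (G T : sgraph V) : Prop :=
  subrel T G /\ is_tree T.

(* Main.v *)
Require Import Defs.
From mathcomp Require Import all_boot.
From mathcomp Require Import boolp classical_sets functions cardinality.

Set Implicit Arguments.
Unset Strict Implicit.
Unset Printing Implicit Defensive.

(** Every block of [G] is finite, and a finite 2k-edge-connected graph has k
    edge-disjoint spanning trees; the packings of the blocks are glued.

    Finiteness of blocks ([block_finite]). In a rayless connected graph every
    infinite set of vertices is joined to some vertex [z] by an infinite fan
    of disjoint paths ([infinite_fan]). If a block were infinite, a first fan
    would give a vertex [z] with infinitely many neighbours that all lie in
    one component of [G - z], because [z] does not separate a block. A second
    fan, in [G - z] and towards these neighbours, has a centre [z'] joined to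
    [z] by infinitely many edge-disjoint paths, which no finite set of edges
    can separate.

    Blocks are handled through the relation [tied x y]: no third vertex
    separates [x] from [y]. Two distinct vertices of the same block determine
    it ([block_eq]), and a path between two vertices of a block stays in the
    block ([block_path]); so each block inherits 2k edge-disjoint paths between
    any two of its vertices.

    Finite packing ([tree_packing], the 2k-edge-connected case of the theorem
    of Nash-Williams and Tutte). Colour as many edges as possible with k
    colours so that each colour class is a forest. Let [D] be the set of edges
    reachable from uncoloured edges by exchanges. Maximality forces each colour
    to connect, within [D], the ends of every edge of [D]. Hence the
    edges of [D] in any one colour have the same components as [D], say p of
    them; the edges between different components are all coloured, at most p - 1
    in each colour, because a colour class is a forest. If p >= 2,
    then each component sends out at least 2k edges, so at least kp edges run
    between components, a contradiction. So p = 1 and every colour class is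
    connected.

    Each edge of [G] lies in exactly one block, so giving it the colour that the
    packing of its block assigns to it yields k edge-disjoint connected spanning
    subgraphs of [G]; any spanning trees of these ([spanning_tree_exists]) do. *)

(** * Connectivity and forests in a finite multigraph *)

Section Multigraph.
Import mathcomp.boot.fintype mathcomp.boot.finset.
Variables (V E : finType) (s t : E -> V).
Implicit Types (A B : {set E}) (x y : V) (e f : E).

Definition joined A : rel V := fun x y =>
  [exists e in A, ((s e == x) && (t e == y)) || ((s e == y) && (t e == x))].
Definition conn A := connect (joined A).
Definition spans A e := conn A (s e) (t e).

Lemma conn0 A x : conn A x x. Proof. exact: connect0. Qed.

Lemma conn_sym A : symmetric (conn A).
Proof.
apply: sym_connect_sym => x y; apply: eq_existsb => e.
by rewrite orbC.
Qed.

Lemma conn_trans A : transitive (conn A).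
Proof. exact: connect_trans. Qed.

Definition comp_of A := root (joined A).
Definition components A := [set comp_of A x | x : V].

(** Through canonical representatives, connectivity becomes an equality, and
    so amenable to rewriting. *)
Lemma connP A x y : reflect (comp_of A x = comp_of A y) (conn A x y).
Proof.
by apply: (iffP idP) => /(rootP (conn_sym A)).
Qed.

(** Used with [u] and [v] the ends of an edge that lies on a walk from [x] to
    [y]: another connection of [x] to [y] bypasses this edge. *)
Lemma conn_bypass A x y u v :
  conn A x y -> conn A x u -> conn A v y -> conn A u v.
Proof. by move=> /connP xy /connP xu /connP vy; apply/connP; rewrite -xu xy. Qed.

(** Induction along a walk, without mentioning the walk. *)
Lemma conn_inv A (P : V -> Prop) x y :
    (forall e, e \in A -> P (s e) <-> P (t e)) ->
  conn A x y -> P x -> P y.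
Proof.
move=> hP /connectP[p]; elim: p x => [|z p IHp] x /= => [_ -> //|].
case/andP=> /existsP[e /andP[eA h]] hp hy Px; apply: (IHp z) => //.
by case/orP: h => /andP[/eqP a /eqP b]; subst; move/(hP e eA): Px.
Qed.

Lemma spans_in A e : e \in A -> spans A e.
Proof.
by move=> eA; apply/connect1/existsP; exists e; rewrite eA !eqxx.
Qed.

Lemma conn_gen A B x y :
  (forall e, e \in A -> spans B e) -> conn A x y -> conn B x y.
Proof.
move=> AB Axy; apply: (conn_inv (P := conn B x)) Axy (conn0 _ _).
move=> e /AB; rewrite /spans => h; split => h'; first exact: conn_trans h' h.
by apply: conn_trans h' _; rewrite conn_sym.
Qed.

Lemma connS A B x y : A \subset B -> conn A x y -> conn B x y.
Proof. by move=> /subsetP AB; apply: conn_gen => e /AB /spans_in. Qed.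

Lemma connU1 A e x y : conn (e |: A) x y ->
  [\/ conn A x y, conn A x (s e) /\ conn A (t e) y
    | conn A x (t e) /\ conn A (s e) y].
Proof.
pose P z := [\/ conn A x z, conn A x (s e) /\ conn A (t e) z
    | conn A x (t e) /\ conn A (s e) z].
move=> h; apply: (conn_inv (P := P)) h (Or31 _ _ (conn0 _ _)).
move=> f /setU1P[->|fA].
  split=> [[h|[h _]|[h _]]|[h|[h _]|[h _]]].
  - by apply: Or32; rewrite conn0.
  - by apply: Or32; rewrite conn0.
  - exact: Or31.
  - by apply: Or33; rewrite conn0.
  - exact: Or31.
  - by apply: Or33; rewrite conn0.
have st z : conn A z (s f) = conn A z (t f).
  have h := spans_in fA; apply/idP/idP => h'; first exact: conn_trans h' h.
  by apply: conn_trans h' _; rewrite conn_sym.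
by rewrite /P !st.
Qed.

Lemma setU1D1 A e f : f != e -> (e |: A) :\ f = e |: (A :\ f).
Proof.
move=> fe; apply/setP => g; rewrite !inE.
by have [->|] //= := eqVneq g e; rewrite eq_sym fe.
Qed.

(** Acyclicity without cycles: every edge is a bridge. *)
Definition forest A := [forall e in A, ~~ spans (A :\ e) e].

Lemma forestP A : reflect (forall e, e \in A -> ~~ spans (A :\ e) e) (forest A).
Proof. exact: forall_inP. Qed.

Lemma forestS A B : A \subset B -> forest B -> forest A.
Proof.
move=> AB /forestP fB; apply/forestP => e eA.
have := fB e (subsetP AB e eA); apply: contra; apply: connS.
exact: setSD.
Qed.

Lemma forestU1 A e : forest A -> ~~ spans A e -> forest (e |: A).
Proof.
move=> fA nAe; apply/forestP => f /setU1P[->|fA'].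
  apply: contra nAe; apply: connS.
  by apply/subsetP => g; rewrite !inE => /andP[/negPf->].
have [->|fe] := eqVneq f e.
  apply: contra nAe; apply: connS.
  by apply/subsetP => g; rewrite !inE => /andP[/negPf->].
rewrite setU1D1 //.
apply/negP => /connU1 h.
have sA z w : conn (A :\ f) z w -> conn A z w by apply/connS/subsetDl.
have := forestP _ fA f fA'; case: h => [|[/sA h1 /sA h2]|[/sA h1 /sA h2] _].
- by rewrite /spans => ->.
- case/negP: nAe; have := spans_in fA'; rewrite /spans => h.
  exact: conn_bypass h h1 h2.
- case/negP: nAe; have := spans_in fA'; rewrite /spans => h.
  by rewrite conn_sym; exact: conn_bypass h h1 h2.
Qed.

(** In a forest the edges whose removal separates the ends of [e] are those
    of the path between these ends; they all lie in any minimal subset [B] that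
    still connects the ends, since a walk avoiding such an edge [f] of [B] would
    close a cycle through [f]. *)
Lemma forest_bridges A e : forest A -> spans A e ->
  spans [set f in A | ~~ spans (A :\ f) e] e.
Proof.
move=> fA Ae; have [B /minsetP[Be minB] BA] := minset_exists (P := spans^~ e) Ae.
apply: connS (Be); apply/subsetP => f fB; rewrite inE (subsetP BA) //=.
have fA' := subsetP BA _ fB.
have nB : ~~ spans (B :\ f) e.
  apply/negP => h; have := minB _ h (subsetDl _ _).
  by move/setP/(_ f); rewrite !inE eqxx fB.
have := forestP _ fA f fA'; apply: contra; rewrite /spans => h.
have sA z w : conn (B :\ f) z w -> conn (A :\ f) z w by apply/connS/setSD.
move: Be; rewrite /spans -(setD1K fB) => /connU1.
case=> [h'|[/sA h1 /sA h2]|[/sA h1 /sA h2]]; first by rewrite /spans h' in nB.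
- exact: conn_bypass h h1 h2.
- by rewrite conn_sym; exact: conn_bypass h h1 h2.
Qed.


(** The components of [e |: A] are the images of those of [A], and two of them
    get identified. *)
Lemma components_proper A e :
  ~~ spans A e -> #|components (e |: A)| < #|components A|.
Proof.
move=> nA; set B := e |: A.
have AB z w : conn A z w -> conn B z w by apply/connS/subsetUr.
have rr x : comp_of B (comp_of A x) = comp_of B x.
  by apply/connP/AB; rewrite conn_sym; apply: connect_root.
have -> : components B = comp_of B @: components A.
  by rewrite -imset_comp; apply: eq_imset => x /=; rewrite rr.
rewrite ltn_neqAle leq_imset_card andbT; apply/negP => /imset_injP inj.
case/negP: nA; apply/connP/inj; try exact: imset_f.
by rewrite !rr; apply/connP/spans_in/setU11.
Qed.

(** The edges of [A] outside [B] are added to [B] one by one, and each merges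
    two components. *)
Lemma forest_components A B : forest A -> B \subset A ->
  #|A :\: B| + #|components A| <= #|components B|.
Proof.
move=> fA; have [n] := ubnP #|A :\: B|; elim: n B => // n IHn B.
rewrite ltnS => len BA; have [AB0|[e]] := set_0Vmem (A :\: B).
  rewrite AB0 cards0 add0n.
  have -> // : A = B by apply/eqP; rewrite eqEsubset BA andbT -setD_eq0 AB0.
rewrite inE => /andP[eB eA].
have ABe : A :\: B = e |: (A :\: (e |: B)).
  apply/setP => f; rewrite !inE negb_or; case: eqP => //= ->.
  by rewrite eB eA.
have cE : #|A :\: B| = #|A :\: (e |: B)|.+1.
  by rewrite ABe cardsU1 !inE eqxx.
have := IHn (e |: B); rewrite -cE subUset sub1set eA BA => /(_ len isT) h.
have nB : ~~ spans B e.
  have := forestP _ fA e eA; apply: contra; apply: connS.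
  apply/subsetP => f fB; rewrite !inE (subsetP BA) // andbT.
  by apply: contraNneq eB => <-.
rewrite cE addSn; exact: leq_ltn_trans h (components_proper nB).
Qed.

(** * Packing spanning trees in a finite multigraph *)

Variable k : nat.
Implicit Type c : {ffun E -> option 'I_k}.
Definition colour c i := [set e | c e == Some i].
Definition forest_coloring c := [forall i, forest (colour c i)].
Definition weight c := #|[set e | c e != None]|.
Definition recolour c e i : {ffun E -> option 'I_k} :=
  [ffun f => if f == e then Some i else c f].

Lemma colour_recolour c e i j :
  colour (recolour c e i) j = if j == i then e |: colour c i else colour c j :\ e.
Proof.
apply/setP => f; have [->|ji] := eqVneq j i; rewrite !inE ffunE;
  have [->|fe] //= := eqVneq f e; first by rewrite eqxx.
by apply/eqP => -[ij]; rewrite ij eqxx in ji.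
Qed.

Lemma forest_coloring_recolour c e i :
  forest_coloring c -> ~~ spans (colour c i) e -> forest_coloring (recolour c e i).
Proof.
move=> /forallP fc nce; apply/forallP => j; rewrite colour_recolour.
by case: eqP => _; [exact: forestU1 | apply: forestS (fc j); exact: subsetDl].
Qed.

(** [f] may be traded for [e] in some colour: if [e] joins the colour class of
    [f] and closes a cycle, then the cycle passes through [f]. The case where [e]
    closes no cycle is not excluded; this makes the relation monotone under
    removal of edges from a class, as [exchange_spans] requires. *)
Definition exchange c : rel E := fun e f =>
  [exists i, (f \in colour c i) && ~~ spans (colour c i :\ f) e].

Definition max_coloring c :=
  forest_coloring c /\ forall c', forest_coloring c' -> weight c' <= weight c.

Lemma weight_recolour c e i :
  weight (recolour c e i) = (c e == None) + weight c.
Proof.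
rewrite /weight (_ : [set f | _] = e |: [set f | c f != None]); last first.
  by apply/setP => f; rewrite !inE ffunE; case: (f == e).
by rewrite cardsU1 inE negbK.
Qed.

(** A chain of exchanges from an uncoloured edge to an edge [f] whose ends are
    not connected in colour [i] would allow a larger colouring. If the chain is
    trivial, colour the edge with [i]. Otherwise, recolour only the last edge [f]
    with [i]: the total weight is unchanged, and the predecessor of [f], whose
    cycle in the old colour of [f] is now broken, ends a shorter chain of the
    same kind. That this chain survives the recolouring uses the induction
    hypothesis for its own, shorter, initial segments. *)
Lemma exchange_spans c e p i : max_coloring c -> c e = None ->
  path (exchange c) e p -> spans (colour c i) (last e p).
Proof.
have [n] := ubnP (size p); elim: n c p i => // n IHn c p i; rewrite ltnS.
case/lastP: p => [_ [fc mc] ce _ /=|p f]; last first.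
  rewrite size_rcons last_rcons rcons_path => lpn [fc mc] ce /andP[hp].
  have IHc q j : size q <= size p -> path (exchange c) e q ->
      spans (colour c j) (last e q).
    by move=> qp; apply: IHn => //; exact: leq_ltn_trans qp lpn.
  case/existsP=> l /andP[fl nl]; apply/negPn/negP => ni.
  have li : l != i by apply: contraNneq ni => <-; exact: spans_in.
  have fe : f != e by apply: contraTneq fl => ->; rewrite inE ce.
  have fNone : (c f == None) = false by move: fl; rewrite inE => /eqP->.
  have mc' : max_coloring (recolour c f i).
    split=> [|c' /mc]; first exact: forest_coloring_recolour.
    by rewrite weight_recolour fNone.
  have ce' : recolour c f i e = None by rewrite ffunE eq_sym (negPf fe).
  suff hp' : path (exchange (recolour c f i)) e p.
    have := IHn (recolour c f i) p l lpn mc' ce' hp'.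
    by rewrite colour_recolour (negPf li) (negPf nl).
  have fp : f \notin p.
    apply/negP => fp; move: hp IHc; case/splitPr: fp => p1 p2 hp IHc.
    case/negP: ni; have := IHc (rcons p1 f) i; rewrite last_rcons; apply.
      by rewrite size_rcons size_cat /= addnS ltnS leq_addr.
    by move: hp; rewrite -cat_rcons cat_path => /andP[].
  have nterm g : g \in e :: p -> spans (colour c i) g.
    move=> gp; move: hp IHc; case/splitPl: gp => p1 p2 lg hp IHc.
    rewrite -lg; apply: IHc; first by rewrite size_cat leq_addr.
    by move: hp; rewrite cat_path => /andP[].
  apply: (sub_in_path (P := [in e :: p])) hp; last exact/allP.
  move=> g h gp hin /existsP[j /andP[hj nj]].
  have hf : h != f.
    move: hin; rewrite inE => /orP[/eqP->|hin]; first by rewrite eq_sym.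
    by apply: contraNneq fp => <-.
  apply/existsP; exists j; rewrite colour_recolour; case: eqP => [ji|ji].
    rewrite inE -ji hj orbT /=; apply/negP.
    rewrite setU1D1 //.
    move/connU1 => hh; subst j; have := nterm g gp; rewrite /spans => hg.
    have sA z w : conn (colour c i :\ h) z w -> conn (colour c i) z w.
      by apply/connS/subsetDl.
    case: hh => [hh|[/sA h1 /sA h2]|[/sA h1 /sA h2]].
    - by rewrite /spans hh in nj.
    - by case/negP: ni; exact: conn_bypass hg h1 h2.
    - by case/negP: ni; rewrite /spans conn_sym; exact: conn_bypass hg h1 h2.
  rewrite in_setD1 hf hj; apply: contra nj; apply: connS.
  by apply/subsetP => a; rewrite !inE => /andP[-> /andP[]].
apply/negPn/negP => ni; have := mc _ (forest_coloring_recolour fc ni).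
by rewrite weight_recolour ce eqxx add1n ltnn.
Qed.

Lemma max_coloring_exists : exists c, max_coloring c.
Proof.
have fc0 : forest_coloring [ffun=> None].
  apply/forallP => i; apply/forestP => e; by rewrite inE ffunE.
case: (arg_maxnP weight fc0) => c fc mc; by exists c; split.
Qed.

(** [D] consists of the edges reachable from uncoloured ones by exchanges. *)
Lemma max_coloring_core c : max_coloring c -> exists D : {set E},
  (forall e, c e = None -> e \in D) /\
  (forall i e, e \in D -> spans (colour c i :&: D) e).
Proof.
move=> mc.
exists [set f | [exists e, (c e == None) && connect (exchange c) e f]]; split.
  by move=> e ce; rewrite inE; apply/existsP; exists e; rewrite ce connect0.
move=> i f; rewrite inE => /existsP[e /andP[/eqP ce /connectP[p hp ->]]].
have fi : forest (colour c i) by case: mc => /forallP.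
have := forest_bridges fi (exchange_spans i mc ce hp); apply: connS.
apply/subsetP => g; rewrite !inE => /andP[gi ng]; rewrite gi /=.
apply/existsP; exists e; rewrite ce eqxx /=.
apply: connect_trans (_ : connect _ e (last e p)) _.
  by apply/connectP; exists p.
by apply/connect1/existsP; exists i; rewrite inE gi.
Qed.

Definition cut (U : {set V}) := [set e | (s e \in U) != (t e \in U)].

(** An edge between two components is counted in the cuts of both. *)
Lemma sum_cut_components A (X := [set e | ~~ spans A e]) :
  \sum_(r in components A) #|cut [set x | comp_of A x == r]| <= 2 * #|X|.
Proof.
have splitX (g : E -> V) :
    #|X| = \sum_(r in components A) #|[set e in X | comp_of A (g e) == r]|.
  rewrite -sum1_card.
  rewrite (partition_big (fun e => comp_of A (g e)) (mem (components A))) /=.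
    by apply: eq_bigr => r _; rewrite -sum1_card; apply: eq_bigl => e; rewrite !inE.
  by move=> e _; exact: imset_f.
rewrite mul2n -addnn {1}(splitX s) (splitX t) -big_split /=.
apply: leq_sum => r _; apply: leq_trans (leq_card_setU _ _).
apply/subset_leq_card/subsetP => e.
rewrite [e \in cut _]inE !(in_set (fun x => _ == r)) => h.
have eX : e \in X.
  by rewrite inE; apply: contra h => /connP ->.
by rewrite in_setU !(in_set (fun e => (e \in X) && _)) eX;
  move: h; do 2!case: (_ == r).
Qed.

(** With p components of [D], the 2k-cut condition gives at least kp edges
    between components, whereas each of the k forests provides at most p - 1. *)
Theorem tree_packing : 0 < k ->
    (forall U : {set V}, U != set0 -> U != setT -> 2 * k <= #|cut U|) ->
  exists c, forall i x y, conn (colour c i) x y.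
Proof.
move=> k0 hcut; have [c mc] := max_coloring_exists; exists c.
have [D [cD sD]] := max_coloring_core mc.
suff DT x y : conn D x y.
  move=> i x y; apply: connS (subsetIl _ D) _.
  by apply: conn_gen (DT x y) => e; exact: sD.
apply/negPn/negP => nxy; set X := [set e | ~~ spans D e].
have h1 : k * #|components D| <= #|X|.
  rewrite -(leq_pmul2l (m := 2)) //; apply: leq_trans (sum_cut_components D).
  rewrite mulnA mulnC -sum_nat_const; apply: leq_sum => r /imsetP[z _ ->].
  apply: hcut; first by apply/set0Pn; exists z; rewrite inE.
  apply: contraNneq nxy => /setP h; apply/connP.
  by have := h x; have := h y; rewrite !inE => /eqP-> /eqP->.
have h2 i : #|X :&: colour c i| < #|components D|.
  have fi : forest (colour c i) by case: mc => /forallP.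
  have := forest_components fi (subsetIl _ D).
  have -> : components (colour c i :&: D) = components D.
    rewrite /components.
    have e z w : conn (colour c i :&: D) z w = conn D z w.
      by apply/idP/idP; [apply/connS/subsetIr | apply: conn_gen => e; exact: sD].
    apply: eq_imset => z; rewrite /comp_of /root; congr odflt.
    by apply: eq_pick => w; exact: e.
  apply: leq_trans; rewrite -addn1 leq_add //; last first.
    by apply/card_gt0P; exists (comp_of (colour c i) x); exact: imset_f.
  apply/subset_leq_card/subsetP => e; rewrite !inE => /andP[nD ->].
  by rewrite andbT /=; apply: contra nD; exact: spans_in.
have h3 : #|X| <= \sum_(i < k) #|X :&: colour c i|.
  rewrite -sum1_card.
  rewrite (eq_bigr (fun i => \sum_(e in X | c e == Some i) 1)); last first.
    by move=> i _; rewrite -sum1_card; apply: eq_bigl => e; rewrite !inE.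
  rewrite (exchange_big_dep (mem X)) /=; last by move=> i e _ /andP[].
  apply: leq_sum => e eX; rewrite sum1_card; apply/card_gt0P.
  case ce: (c e) => [i|]; first by exists i; apply/andP; split => //; apply/eqP.
  by move: eX; rewrite inE => /negP[]; exact/spans_in/cD.
have: k * #|components D| <= k * #|components D|.-1.
  apply: leq_trans (leq_trans h1 h3) _.
  rewrite -[k in k * _]card_ord -sum_nat_const; apply: leq_sum => i _.
  by have := h2 i; case: #|components D|.
rewrite leq_pmul2l //; have := h2 (Ordinal k0).
by case: #|components D| => //= n _; rewrite ltnn.
Qed.

End Multigraph.

Local Open Scope classical_set_scope.

(** * Walks, fans and spanning trees in infinite graphs *)

Section Linked.
Variable V0 : Type.
Local Notation V := {classic V0}.
Implicit Types (R H : rel V) (x y z w r : V) (p q : seq V).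

Definition linked R x y := exists2 p, path R x p & last x p = y.

Lemma linked0 R x : linked R x x. Proof. by exists [::]. Qed.

Lemma linked1 R x y : R x y -> linked R x y.
Proof. by move=> xy; exists [:: y] => //=; rewrite xy. Qed.

Lemma linked_trans R x y z : linked R x y -> linked R y z -> linked R x z.
Proof.
move=> [p hp <-] [q hq <-]; exists (p ++ q); last by rewrite last_cat.
by rewrite cat_path hp.
Qed.

Lemma linked_sym R x y : symmetric R -> linked R x y -> linked R y x.
Proof.
move=> sR [p hp <-]; exists (rev (belast x p)).
  by rewrite rev_path; apply: sub_path hp => a b; rewrite sR.
by case: p {hp} => //= a p; rewrite rev_cons last_rcons.
Qed.

Lemma linked_sub R R' x y : subrel R R' -> linked R x y -> linked R' x y.
Proof. by move=> RR' [p hp <-]; exists p => //; apply: sub_path hp. Qed.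

Lemma linked_inv R (P : V -> Prop) x y :
  (forall a b, R a b -> P a -> P b) -> linked R x y -> P x -> P y.
Proof.
move=> hP [p hp <-]; elim: p x hp => //= a p IHp x /andP[xa hp] Px.
exact: IHp hp (hP _ _ xa Px).
Qed.

(** Breadth-first search from [r]: [h] is the distance from [r], and [par x]
    the last but one vertex of a shortest path to [x]. *)
Lemma bfs R r : exists (h : V -> nat) (par : V -> V), h r = 0 /\
  forall x, linked R r x -> x <> r ->
    [/\ linked R r (par x), R (par x) x & h x = (h (par x)).+1].
Proof.
pose P x n := `[< exists p, [/\ path R r p, last r p = x & size p = n] >].
have exP x : linked R r x -> exists n, P x n.
  by case=> p hp lp; exists (size p); apply/asboolP; exists p.
have /choice[h hP] : forall x, exists n, linked R r x ->
    P x n /\ forall m, P x m -> n <= m.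
  move=> x; have [l|nl] := pselect (linked R r x); last by exists 0.
  by exists (ex_minn (exP x l)) => _; case: ex_minnP.
have hr : h r = 0.
  have [_ m] := hP r (linked0 R r); apply/eqP; rewrite -leqn0; apply: m.
  by apply/asboolP; exists [::].
exists h.
suff /choice[par hpar] : forall x, exists y, linked R r x -> x <> r ->
    [/\ linked R r y, R y x & h x = (h y).+1] by exists par.
move=> x; have [l|nl] := pselect (linked R r x); last by exists x.
have [/asboolP[p [hp lp sp]] minx] := hP x l.
case/lastP: p => [|p y] in hp lp sp; first by exists x => _ []; rewrite -lp.
move: hp lp sp; rewrite last_rcons rcons_path size_rcons => /andP[hp yx] xy sp.
subst y.
exists (last r p) => _ _; have ly : linked R r (last r p) by exists p.
split => //; apply/eqP; rewrite eqn_leq.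
have [/asboolP[q [hq lq sq]] miny] := hP _ ly.
rewrite minx /=; last first.
  apply/asboolP; exists (rcons q x).
  by rewrite rcons_path hq lq yx last_rcons size_rcons sq.
by rewrite -sp ltnS; apply: miny; apply/asboolP; exists p.
Qed.

Definition ray_free R :=
  ~ exists u : nat -> V, injective u /\ forall n, R (u n) (u n.+1).

(** When each vertex has at most one predecessor, a path is determined by its
    end and its length. *)
Lemma back_det R p q x y : (forall a b c, R a c -> R b c -> a = b) ->
  path R x p -> path R y q -> size p = size q -> last x p = last y q -> x = y.
Proof.
move=> dR; elim/last_ind: p q => [|p a IHp]; case/lastP => [|q b] //=;
  rewrite ?size_rcons // ?rcons_path ?last_rcons.
move=> /andP[hp pa] /andP[hq qb] [] spq ab; subst b.
by apply: (IHp q) => //; exact: dR pa qb.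
Qed.

(** In a breadth-first search tree, follow the vertices with infinitely many
    descendants in [X], starting from [r]. If each of them had only finitely many
    children with descendants in [X], then one child would again have infinitely
    many, and this would produce a ray. So some [z] has infinitely many such
    children; the tree paths that descend from them to [X] are disjoint. *)
Lemma infinite_fan R r (X : set V) : ray_free R -> infinite_set X ->
    (forall x, X x -> linked R r x) ->
  exists z (C : set V) (Q : V -> seq V),
    [/\ infinite_set C,
        forall c, C c ->
          [/\ R z c, path R c (Q c), X (last c (Q c)) & z \notin c :: Q c] &
        forall c c' a, C c -> C c' -> a \in c :: Q c -> a \in c' :: Q c' -> c = c'].
Proof.
move=> nray infX XR; have [h [par [hr hpar]]] := bfs R r.
(* the edges of the search tree, directed away from [r] *)
pose T : rel V := fun a b => `[< [/\ linked R r b, b <> r & par b = a] >].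
have TR a b : T a b -> R a b by case/asboolP => lb br <-; case: (hpar b).
have Th a b : T a b -> h b = (h a).+1 by case/asboolP => lb br <-; case: (hpar b).
have Tdet a b c : T a c -> T b c -> a = b.
  by move=> /asboolP[_ _ <-] /asboolP[_ _ <-].
have hpath p a : path T a p -> h (last a p) = h a + size p.
  elim: p a => [|b p IHp] a /=; first by rewrite addn0.
  by case/andP=> /Th ab /IHp ->; rewrite ab addSnnS.
have Tr x : linked R r x -> linked T r x.
  have [n] := ubnP (h x); elim: n x => // n IHn x; rewrite ltnS => hx lx.
  have [->|xr] := pselect (x = r); first exact: linked0.
  have [lp pR hp] := hpar x lx xr.
  apply: linked_trans (IHn _ _ lp) (linked1 _); first by rewrite -hp.
  exact/asboolP.
(* the descendants of [z] in [X], and the children of [z] that have some *)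
pose D z := [set x | X x /\ linked T z x].
pose Ch z := [set c | T z c /\ D c !=set0].
have Dr : infinite_set (D r).
  by rewrite (_ : D r = X) //; apply/seteqP; split => [x []|x Xx] //; split; auto.
have [[z Cz]|nz] := pselect (exists z, infinite_set (Ch z)).
  have /choice[Q hQ] : forall c, exists q,
      Ch z c -> path T c q /\ X (last c q).
    move=> c; have [[zc [x [Xx [q hq lq]]]]|nc] := pselect (Ch z c).
      by exists q => _; rewrite lq.
    by exists [::].
  have hQ1 c : Ch z c -> path T c (Q c) by case/hQ.
  have hQ2 c : Ch z c -> X (last c (Q c)) by case/hQ.
  have sub c a : Ch z c -> a \in c :: Q c ->
      exists p, [/\ path T c p, last c p = a & h a = h z + (size p).+1].
    move=> Cc ac; have := hQ1 c Cc; case/splitPl: ac => p1 p2 lp.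
    rewrite cat_path => /andP[hp _]; exists p1; split => //.
    by rewrite -lp (hpath _ _ hp); case: Cc => /Th -> _; rewrite addSnnS.
  exists z, (Ch z), Q; split => //.
  - move=> c Cc; split;
      [by case: Cc => /TR|exact: sub_path TR _ _ (hQ1 c Cc)|exact: hQ2|].
    apply/negP => /(sub _ _ Cc)[p [_ _ /eqP]].
    by rewrite -[X in X == _]addn0 eqn_add2l.
  - move=> c c' a Cc Cc' /(sub _ _ Cc)[p [hp lp hz]] /(sub _ _ Cc')[q [hq lq hz']].
    apply: back_det Tdet hp hq _ _; last by rewrite lp.
    by apply/eqP; have := etrans (esym hz) hz' => /eqP; rewrite eqn_add2l eqSS.
exfalso; apply: nray.
have step z : exists c, infinite_set (D z) -> T z c /\ infinite_set (D c).
  have [Dz|n] := pselect (infinite_set (D z)); last by exists z.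
  apply: contrapT => nc; apply: nz; exists z => fC; apply: Dz.
  apply: (@sub_finite_set _ _ ([set z] `|` \bigcup_(c in Ch z) D c)).
    move=> x [Xx [[|c p] /= hp lp]]; [by left|right].
    case/andP: hp => zc hp; have Dcx : D c x by split => //; exists p.
    by exists c => //; split => //; exists x.
  rewrite finite_setU; split; first exact: finite_set1.
  apply: bigcup_finite => // c [zc _]; apply: contrapT => Dc.
  by apply: nc; exists c.
have [nx hnx] := choice step.
have inv n : infinite_set (D (iter n nx r)).
  by elim: n => [|n IHn] //=; have [] := hnx _ IHn.
have hT n : T (iter n nx r) (iter n.+1 nx r) by have [] := hnx _ (inv n).
have hh n : h (iter n nx r) = n.
  by elim: n => [|n IHn]; [exact: hr | rewrite (Th _ _ (hT n)) IHn].
exists (fun n => iter n nx r); split => [m n /(congr1 h)|n]; last exact/TR/hT.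
by rewrite !hh.
Qed.

(** Each vertex of [F] lies on at most one path of the fan. *)
Lemma fan_avoiding (C : set V) (Q : V -> seq V) (F : set V) :
    infinite_set C -> finite_set F ->
    (forall c c' a, C c -> C c' -> a \in c :: Q c -> a \in c' :: Q c' -> c = c') ->
  exists2 c, C c & forall a, a \in c :: Q c -> ~ F a.
Proof.
move=> infC finF disj; apply: contrapT => nc; apply: infC.
have /choice[f hf] : forall c, exists a, C c -> F a /\ a \in c :: Q c.
  move=> c; have [Cc|] := pselect (C c); last by exists c.
  apply: contrapT => na; apply: nc; exists c => // a ac Fa.
  by apply: na; exists a.
have inj : {in C &, injective f}.
  move=> c c' /set_mem Cc /set_mem Cc' ff.
  have [_ a1] := hf c Cc; have [_ a2] := hf c' Cc'.
  by apply: (disj c c' (f c)) => //; rewrite ff.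
rewrite -(eq_finite_set (inj_card_eq inj)); apply: sub_finite_set finF.
by move=> _ [c Cc <-]; case: (hf c Cc).
Qed.

(** A breadth-first search tree. A vertex of a cycle at maximal distance from
    the root would have both its neighbours on the cycle as parent. *)
Lemma spanning_tree_exists (H : rel V) r : symmetric H ->
  (forall x, linked H r x) -> exists T : sgraph V0, subrel T H /\ is_tree T.
Proof.
move=> symH Hr; have [h [par [hr hpar]]] := bfs H r.
have hp x : x <> r -> H (par x) x /\ h x = (h (par x)).+1.
  by move=> xr; case: (hpar x).
pose A : rel V := fun x y => (x != r) && (par x == y).
have Ah x y : A x y -> H y x /\ h x = (h y).+1.
  by case/andP=> /eqP /hp + /eqP <-.
pose T0 : rel V := fun x y => A x y || A y x.
have symT : symmetric T0 by move=> x y; rewrite /T0 orbC.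
have irrT : irreflexive T0.
  move=> x; apply/negP; rewrite /T0 orbb => /Ah[_ /eqP].
  by rewrite eqn_leq ltnn andbF.
exists (@SGraph V0 T0 symT irrT); split; last split.
- by move=> x y /orP[/Ah[]|/Ah[]//]; rewrite symH.
- have toR x : linked T0 x r.
    have [n] := ubnP (h x); elim: n x => // n IHn x; rewrite ltnS => hx.
    have [->|/eqP xr] := pselect (x = r); first exact: linked0.
    have [_ e] := hp x (elimN eqP xr).
    apply: linked_trans (linked1 (_ : T0 x (par x))) (IHn _ _).
      by rewrite /T0 /A xr eqxx.
    by rewrite -e.
  move=> x y; have [p hpth lp] : linked T0 x y.
    exact: linked_trans (toR x) (linked_sym symT (toR y)).
  move: lp; case: (shortenP (T := V) hpth) => q hq uq _ lq.
  by exists q; split.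
- case=> c [sc cc uc].
  have [v vc vmax] : exists2 v, v \in (c : seq V) &
      forall w, w \in (c : seq V) -> h w <= h v.
    case: c sc {cc uc} => // a c _; elim: c a => [|b c IHc] a.
      by exists a; [rewrite inE | move=> w; rewrite inE => /eqP->].
    have [v vc vm] := IHc b; case: (leqP (h v) (h a)) => hva.
      exists a; rewrite ?mem_head // => w; rewrite inE => /orP[/eqP-> //|/vm].
      by move/leq_trans; apply.
    exists v => [|w]; first by rewrite inE vc orbT.
    rewrite inE => /orP[/eqP->|/vm //].
    exact: ltnW.
  have up w : w \in (c : seq V) -> T0 v w -> w = par v.
    move=> /vmax wv /orP[/andP[_ /eqP] //|/Ah[_ e]].
    by move: wv; rewrite e ltnn.
  have [i c' rc] := rot_to vc.
  have mc' w : w \in c' -> w \in (c : seq V).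
    by move=> wc; rewrite -(mem_rot i) rc inE wc orbT.
  move: sc; rewrite -(size_rot i) rc; move: cc; rewrite -(rot_cycle i).
  rewrite [X in cycle _ X]rc; move: uc; rewrite -(rot_uniq i) [X in uniq X]rc.
  case: c' mc' {rc} => [|a [|b c']] // mc' /= /and3P[_ anb _] /andP[va].
  case/andP=> _; rewrite rcons_path => /andP[_ bv] _.
  have ea := up a (mc' a (mem_head _ _)) va.
  have lb : last b c' \in b :: c' by exact: mem_last.
  have eb := up (last b c') (mc' _ (mem_behead (s := a :: b :: c') lb)).
  case/negP: anb; rewrite ea -eb //.
  by move: bv; rewrite /= symT.
Qed.

End Linked.

(** * Blocks *)

Section Blocks.
Variables (V0 : Type) (G : sgraph V0).
Local Notation V := {classic V0}.
Implicit Types (x y z u v w a b : V).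

Definition del w : rel V := fun x y => [&& G x y, x != w & y != w].

Lemma del_sym w : symmetric (del w).
Proof. by move=> x y; rewrite /del adj_sym (andbC (x != w)). Qed.

Lemma path_del w x p : path G x p -> w \notin (x :: p : seq V) -> path (del w) x p.
Proof.
elim: p x => [//|a p IHp] x /andP[xa hp].
rewrite in_cons negb_or => /andP[wx wp]; apply/andP; split; last exact: IHp.
move: wp; rewrite in_cons negb_or => /andP[wa _].
by rewrite /del xa !(eq_sym _ w) wx wa.
Qed.

Definition tied x y := forall w, w <> x -> w <> y -> linked (del w) x y.

Lemma tied0 x : tied x x. Proof. by move=> w _ _; exact: linked0. Qed.

Lemma tied_sym x y : tied x y -> tied y x.
Proof. by move=> xy w wy wx; apply: linked_sym (xy w wx wy); exact: del_sym. Qed.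

Lemma tied_adj x y : G x y -> tied x y.
Proof.
move=> xy w /eqP wx /eqP wy; apply: linked1.
by rewrite /del xy !(eq_sym _ w) wx.
Qed.

(** [tied] is not transitive, because a cut vertex is tied to vertices of
    several blocks; but a third vertex cannot be equal to both [u] and [v]. *)
Lemma tied_trans2 u v x y : u <> v ->
  tied x u -> tied x v -> tied u y -> tied v y -> tied x y.
Proof.
move=> uv xu xv uy vy w wx wy; have [wu|wu] := pselect (w = u).
  have wv : w <> v by rewrite wu.
  exact: linked_trans (xv w wx wv) (vy w wv wy).
exact: linked_trans (xu w wx wu) (uy w wu wy).
Qed.

(** When [x] and [y] are distinct and tied, this is the block that contains
    both. *)
Definition block x y := [set z : V | tied x z /\ tied y z].

Lemma block_tied u v a b : u <> v -> block u v a -> block u v b -> tied a b.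
Proof.
by move=> uv [ua va] [ub vb]; apply: (tied_trans2 uv) => //; exact: tied_sym.
Qed.

Lemma block_eq u v a b : u <> v -> tied u v ->
  block u v a -> block u v b -> a <> b ->
  block a b = block u v.
Proof.
move=> uv tuv Ba Bb ab; have ta := block_tied uv Ba; have tb := block_tied uv Bb.
case: (Ba) (Bb) => ua va [ub vb].
apply/seteqP; split => z; last by move=> Bz; split; [exact: ta|exact: tb].
move=> [az bz].
by split; [exact: (tied_trans2 ab ua ub)|exact: (tied_trans2 ab va vb)].
Qed.

(** A vertex [w] that separates [z] from [a] must lie on the segment of the
    path between [a] and [z]; then the rest of the path joins [z] to [b] and
    avoids [w], and [b] is connected to [a] in [G - w]. *)
Lemma block_path a b p z : tied a b -> upath G a p b ->
  z \in (a :: p : seq V) -> block a b z.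
Proof.
move=> tab [hp lp up] zp; move: hp lp up; case/splitPl: zp => p1 p2 lz.
rewrite cat_path last_cat lz -cat_cons cat_uniq => /andP[hp1 hp2] lb /and3P[_ dis _].
have out w : w \in a :: p1 -> w <> z -> w \notin z :: p2.
  move=> w1 wz; rewrite inE negb_or; apply/andP; split; first exact/eqP.
  by apply/negP => w2; case/hasP: dis; exists w.
have la w : w \notin a :: p1 -> linked (del w) a z.
  by move=> wp; exists p1 => //; exact: path_del.
have lb' w : w \notin z :: p2 -> linked (del w) z b.
  by move=> wp; exists p2 => //; exact: path_del.
split => w wx wz.
  have [w1|/la //] := boolP (w \in a :: p1).
  have w2 := out w w1 wz; have wb : w <> b.
    by move=> wb; move: w2; rewrite wb -lb mem_last.
  exact: linked_trans (tab w wx wb) (linked_sym (del_sym w) (lb' w w2)).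
have [w1|w1] := boolP (w \in a :: p1); last first.
  have wa : w <> a by move=> wa; rewrite wa mem_head in w1.
  exact: linked_trans (linked_sym (del_sym w) (tab w wa wx)) (la w w1).
exact: linked_sym (del_sym w) (lb' w (out w w1 wz)).
Qed.

Lemma linked_upath (R : rel V) x y : linked R x y ->
  exists p, [/\ path R x p, last x p = y & uniq (x :: p : seq V)].
Proof. by case=> p hp <-; case: (shortenP (T := V) hp) => q hq uq _; exists q. Qed.

Lemma not_separated (R : rel V) (F : set (set V0)) x y :
    (forall a b, R a b -> G a b /\ ~ F [set a; b]) ->
  linked R x y -> ~ separates G F x y.
Proof.
move=> hR /linked_upath[p [hp lp up]] /(_ p) [].
  by split=> //; apply: sub_path hp => a b /hR[].
move=> e; elim: p x hp {lp up} => [|a p IHp] x /=; first by move=> _ [[]].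
by move=> /andP[/hR[_ nF] hp] [[->|ep] Fe] //; exact: (IHp a hp).
Qed.

(** The centre [z] of a fan towards the block has infinitely many neighbours
    [C] in one component of [G - z]; the centre [z'] of a fan towards [C] in
    [G - z] cannot be separated from [z] by finitely many edges. *)
Lemma block_finite u v : u <> v -> (forall x y, linked G x y) ->
  rayless G -> finitely_edge_separable G -> finite_set (block u v).
Proof.
move=> uv Gc ray sep; apply: contrapT => infB.
have [z [C [Q [infC hC _]]]] := infinite_fan ray infB (fun x _ => Gc u x).
have CB c : C c -> exists x, [/\ block u v x, x <> z & linked (del z) c x].
  move=> /hC[_ hp Bx zp]; exists (last c (Q c)); split => //.
    by move=> lz; move: zp; rewrite -lz mem_last.
  by exists (Q c) => //; exact: path_del.
have [c0 C0] : C !=set0 by exact: infinite_setN0.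
have Clink c : C c -> linked (del z) c0 c.
  move=> /CB[x [Bx xz cx]]; have [y [By yz cy]] := CB c0 C0.
  have yx : linked (del z) y x by apply: (block_tied uv By Bx); exact: nesym.
  exact: linked_trans cy (linked_trans yx (linked_sym (del_sym z) cx)).
have ray' : ray_free (del z).
  by case=> r [ir hr]; apply: ray; exists r; split => // n; case/andP: (hr n).
have [z' [C' [Q' [infC' hC' disj]]]] := infinite_fan ray' infC Clink.
have z'z : z' <> z.
  have [c] := infinite_setN0 infC'.
  by move=> /hC'[/and3P[_ /eqP]].
have [F [finF FG sepF]] := sep z' z z'z.
(* a path of the second fan that meets no end of an edge of [F] *)
have finW : finite_set (\bigcup_(e in F) e).
  by apply: bigcup_finite => // e /FG[x [y [_ ->]]]; exact: finite_set2.
have [c C'c avoid] := fan_avoiding infC' finW disj.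
have [zc hp Cl _] := hC' c C'c.
pose S : rel V := fun a b => G a b && `[< ~ F [set a; b] >].
have nF a b : b \in c :: Q' c -> `[< ~ F [set a; b] >].
  move=> /avoid nb; apply/asboolP => Fe; apply: nb.
  by exists [set a; b] => //; right.
apply: (@not_separated S F z' z _ _ sepF).
  by move=> a b /andP[ab /asboolP].
have z'c : linked S z' c.
  by apply: linked1; case/andP: zc => zc _; rewrite /S zc; exact/nF/mem_head.
apply: linked_trans z'c (linked_trans (y := last c (Q' c)) _ (linked1 _)).
  exists (Q' c) => //.
  apply: (sub_in_path (P := [in c :: Q' c])) hp; last exact/allP.
  by move=> a b _ bc /andP[ab _]; rewrite /S ab; exact: nF.
have [zl _ _ _] := hC _ Cl.
by rewrite /S adj_sym zl setUC; exact/nF/mem_last.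
Qed.

(** An edge where the path leaves [U]. *)
Lemma path_crosses (U : V -> Prop) x p : U x -> ~ U (last x p) ->
  path G x p -> exists a b,
    [/\ b \in (x :: p : seq V), G a b, U a, ~ U b & path_edges x p [set a; b]].
Proof.
elim: p x => [|b p IHp] x //= Ux nU /andP[xb hp]; have [Ub|nUb] := pselect (U b).
  have [a [c [cp ac Ua nUc e]]] := IHp b Ub nU hp.
  by exists a, c; split=> //; [rewrite inE cp orbT|right].
by exists x, b; split => //; [rewrite !inE eqxx orbT|left].
Qed.

Definition packs (B : set V) k (R : 'I_k -> rel V) :=
  [/\ forall i, symmetric (R i),
      forall i j x y, R i x y -> R j x y -> i = j &
      forall i a b, B a -> B b ->
        linked (fun x y => [&& G x y, `[< B x >], `[< B y >] & R i x y]) a b].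

(** [tree_packing] for the subgraph of [G] induced by [B]: a cut that separates
    [a] from [b] has an edge on each of the 2k edge-disjoint paths. *)
Lemma pack_finite (B : set V) k : 0 < k -> finite_set B ->
    (forall a b, B a -> B b -> a <> b -> exists P : 'I_(2 * k) -> seq V,
      [/\ forall i, upath G a (P i) b, forall i z, z \in (a :: P i : seq V) -> B z &
          trivIset [set: 'I_(2 * k)] (fun i => path_edges a (P i))]) ->
  exists R : 'I_k -> rel V, packs B R.
Proof.
move=> k0 /finite_seqP[s ->] hP.
pose W : finType := seq_sub s.
(* the rank condition keeps one of the two orientations of each edge *)
pose ordered (e : W * W) :=
  G (val e.1) (val e.2) && (enum_rank e.1 < enum_rank e.2)%N.
pose E : finType := {e : W * W | ordered e}.
pose src (e : E) : W := (val e).1; pose tgt (e : E) : W := (val e).2.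
have GE e : G (val (src e)) (val (tgt e)) by case/andP: (valP e).
have mkE (a b : W) : G (val a) (val b) -> exists e,
    (src e = a /\ tgt e = b) \/ (src e = b /\ tgt e = a).
  move=> ab; have [lt|lt|eq] := ltngtP (enum_rank a) (enum_rank b).
  - have h : ordered (a, b) by rewrite /ordered ab.
    by exists (Sub (a, b) h); left.
  - have h : ordered (b, a) by rewrite /ordered adj_sym ab.
    by exists (Sub (b, a) h); right.
  - by move/ord_inj/enum_rank_inj: eq ab => ->; rewrite adj_irr.
have injE (e f : E) :
    (src e = src f /\ tgt e = tgt f) \/ (src e = tgt f /\ tgt e = src f) -> e = f.
  case=> [[ss tt]|[st ts]].
    apply: val_inj; move: ss tt; rewrite /src /tgt.
    by case: (val e) (val f) => ? ? [? ?] /= -> ->.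
  case/andP: (valP e) => _; case/andP: (valP f) => _.
  move: st ts; rewrite /src /tgt => -> ->.
  by move=> lt /(ltn_trans lt); rewrite ltnn.
have [c hc] : exists c : {ffun E -> option 'I_k},
    forall i (x y : W), conn src tgt (colour c i) x y.
  apply: tree_packing => // U /set0Pn[x xU] UT.
  have [y yU] : exists y : W, y \notin U.
    apply/existsP; apply: contraNT UT; rewrite negb_exists => /forallP h.
    by apply/eqP/setP => y; rewrite inE; apply/negPn.
  have [||xy|P [hup hB triv]] := hP (val x) (val y).
  - exact: (valP x).
  - exact: (valP y).
  - by move/val_inj: xy yU => <-; rewrite xU.
  have /choice[f hf] : forall i, exists e, e \in cut src tgt U /\
      path_edges (val x) (P i) [set val (src e); val (tgt e)].
    move=> i; have [hp lp _] := hup i.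
    pose PU (z : V) := exists2 w, w \in U & val w = z.
    have Ux : PU (val x) by exists x.
    have nUy : ~ PU (last (val x) (P i)).
      by rewrite lp => -[w wU /val_inj wy]; rewrite -wy wU in yU.
    have [a [b [bp ab [a' aU av] nb e]]] := path_crosses Ux nUy hp.
    pose b' : W := SeqSub (hB i b bp).
    have bU : b' \notin U by apply/negP => bU; apply: nb; exists b'.
    have [g hg] := mkE a' b' (eq_ind_r (fun t => G t _) ab av).
    exists g; rewrite finset.in_set.
    by case: hg => -[-> ->]; rewrite aU (negPf bU) av // setUC.
  have injf : injective f.
    move=> i j fij; apply: (triv i j) => //.
    exists [set val (src (f i)); val (tgt (f i))].
    by split; [exact: (hf i).2|rewrite fij; exact: (hf j).2].
  rewrite -[X in (X <= _)%N]card_ord -(card_imset _ injf).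
  by apply/subset_leq_card/fintype.subsetP => _ /imsetP[i _ ->]; exact: (hf i).1.
pose R i : rel V := fun x y => [exists e, (c e == Some i) &&
  (((val (src e) == x) && (val (tgt e) == y)) ||
   ((val (src e) == y) && (val (tgt e) == x)))].
have symR i : symmetric (R i).
  by move=> x y; apply: eq_existsb => e; rewrite orbC.
exists R; split => //.
  move=> i j x y /existsP[e /andP[/eqP ei he]] /existsP[f /andP[/eqP fj hf]].
  suff ef : e = f by move: ei; rewrite ef fj => -[].
  apply: injE; case/orP: he => /andP[/eqP a /eqP b];
    case/orP: hf => /andP[/eqP a' /eqP b'];
    (try by left; split; apply: val_inj; congruence);
    by right; split; apply: val_inj; congruence.
move=> i a b Ba Bb; pose a' : W := SeqSub Ba; pose b' : W := SeqSub Bb.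
set L := (fun x y => _).
have symL : symmetric L.
  by move=> x y; rewrite /L adj_sym symR; congr andb; rewrite andbCA.
apply: (conn_inv (P := fun w : W => linked L a (val w)) _ (hc i a' b'));
  last exact: linked0.
move=> e; rewrite inE => ei.
have Le : L (val (src e)) (val (tgt e)).
  rewrite /L; apply/and4P; split; first exact: GE.
  - by apply/asboolP; exact: (valP (src e)).
  - by apply/asboolP; exact: (valP (tgt e)).
  by apply/existsP; exists e; rewrite ei !eqxx.
split=> h; first exact: linked_trans h (linked1 Le).
by apply: linked_trans h (linked1 _); rewrite symL.
Qed.

End Blocks.

(** * Gluing the packings of the blocks *)

Theorem corollary4p1 (V : Type) (G : sgraph V) (k : nat) (k_gt0 : (0 < k)%N)
    (G_conn : edge_connected (2 * k)%N G) (G_rayless : rayless G)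
    (G_sep : finitely_edge_separable G) :
  exists T : 'I_k -> sgraph V,
    (forall i, spanning_tree G (T i)) /\
    trivIset [set: 'I_k]%classic (fun i => edges (T i)).
Proof.
have Gconn (x y : {classic V}) : linked G x y.
  have k2 : 0 < 2 * k by rewrite muln_gt0.
  have [P [hP _]] := G_conn x y; have [hp lp _] := hP (Ordinal k2).
  by exists (P (Ordinal k2)).
pose is_block (B : set {classic V}) :=
  exists u v : {classic V}, [/\ u <> v, tied G u v & B = block G u v].
have /choice[pack hpack] : forall B : set {classic V},
    exists R : 'I_k -> rel {classic V},
    is_block B -> packs G B R.
  move=> B; have [[u [v [uv tuv ->]]]|n] := pselect (is_block B);
    last by exists (fun _ _ _ => false).
  have finB := block_finite uv Gconn G_rayless G_sep.
  have [|R hR] := pack_finite (G := G) k_gt0 finB.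
    move=> a b Ba Bb ab.
    have [P [hP triv]] := G_conn a b; exists P; split => // i z zP.
    rewrite -(block_eq uv tuv Ba Bb ab); apply: block_path (hP i) zP.
    exact: block_tied uv Ba Bb.
  by exists R.
have neq x y : G x y -> x <> y by move=> xy e; move: xy; rewrite e adj_irr.
have goodG (x y : {classic V}) : G x y -> packs G (block G x y) (pack (block G x y)).
  move=> xy; apply: hpack; exists x, y; split => //; first exact: neq.
  exact: tied_adj.
(* an edge is coloured by the packing of the block that contains it *)
pose H i : rel {classic V} := fun x y => G x y && pack (block G x y) i x y.
have blockC x y : block G x y = block G y x.
  by apply/seteqP; split => z [].
have symH i : symmetric (H i).
  suff h x y : H i x y -> H i y x by move=> x y; apply/idP/idP; exact: h.
  case/andP=> xy; have [sp _ _] := goodG x y xy.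
  by move=> pxy; apply/andP; split; [rewrite adj_sym|rewrite (blockC y x) sp].
have disjH i j x y : H i x y -> H j x y -> i = j.
  move=> /andP[xy hi] /andP[_ hj]; have [_ d _] := goodG x y xy; exact: d hi hj.
have HG i : forall x y, H i x y -> G x y by move=> x y /andP[].
have connH i x y : linked (H i) x y.
  apply: (linked_inv (P := fun z => linked (H i) x z)) (Gconn x y) (linked0 _ _).
  move=> a b ab xa; apply: linked_trans xa _.
  have [_ _ l] := goodG a b ab.
  have tab := tied_adj ab.
  have Ba : block G a b a by split; [exact: tied0|exact: tied_sym].
  have Bb : block G a b b by split; [exact: tab|exact: tied0].
  have := l i a b Ba Bb.
  apply: linked_sub => c d /and4P[cd /asboolP Bc /asboolP Bd pcd].
  by rewrite /H cd (block_eq (neq _ _ ab) tab Bc Bd (neq _ _ cd)).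
have /choice[T hT] : forall i, exists T : sgraph V, subrel T (H i) /\ is_tree T.
  move=> i; have [[r _]|nV] := pselect (exists r : V, True).
    exact: spanning_tree_exists (symH i) (connH i r).
  exists G; split; first by move=> x; case: nV; exists x.
  split; first by move=> x; case: nV; exists x.
  by case=> -[|x c] [] // _ _ _; case: nV; exists x.
exists T; split => [i|i j _ _ [_ [[x [y [xy ->]]] [x' [y' [xy' e]]]]]].
  by have [TH tree] := hT i; split => // x y /TH /HG.
have {xy}hi : H i x y by exact: (hT i).1.
have {xy'}hj : H j x' y' by exact: (hT j).1.
have nxy := neq _ _ (HG _ _ _ hi).
have xin : [set x'; y'] x by rewrite -e; left.
have yin : [set x'; y'] y by rewrite -e; right.
apply: (disjH i j x y) => //.
by case: xin => ex; case: yin => ey; rewrite ex ey // in nxy *; rewrite symH.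
Qed.
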